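(* Let $p$ be a prime, $m$ a positive integer and $n=p^m$. Let $\mathbb{F}$ be a field of characteristic $p$ and let $\mathbb{L}/\mathbb{F}$ be a cyclic Galois extension of degree $n$ whose Galois group is generated by $\sigma$. Let $\mathcal{D}=(c_1,\ldots,c_n)$ be a $p$-monotone Ferrers diagram of order $n$. Put $\bar\sigma=\sigma-\mathrm{id}$, $\mathcal{F}_i=\ker(\bar\sigma^i)$ for $i\in\{0,\ldots,n\}$, $\mathcal{F}=(\mathcal{F}_0,\ldots,\mathcal{F}_n)$, and let $\mathcal{B}$ be an $\mathcal{F}$-compatible $\mathbb{F}$-basis of $\mathbb{L}$. Then the map $\phi_{\mathcal{B}}:\mathbb{L}[\sigma]\to\mathbb{F}^{n\times n}$ maps $$\mathbb{L}[\sigma;\mathcal{D}]=\Big\{\sum_{i=1}^n\lambda_i\bar\sigma^{\,i-1}:\lambda_i\in\mathcal{F}_{c_i}\Big\}$$ isomorphically (as an $\mathbb{F}$-vector space) onto $\mathbb{F}^{\mathcal{D}}$.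
   Context: Skew group algebra: $\mathbb{L}[\sigma]=\{\sum_{i=0}^{n-1}a_i\sigma^i:a_i\in\mathbb{L}\}$ with usual addition and multiplication $(a\sigma^i)(b\sigma^j)=a\sigma^i(b)\sigma^{i+j}$ (with $\sigma^n=\mathrm{id}$). It is identified with $\operatorname{End}_{\mathbb{F}}(\mathbb{L})$ by $\sum a_i\sigma^i\mapsto(\alpha\mapsto\sum a_i\sigma^i(\alpha))$, which is an $\mathbb{F}$-algebra isomorphism. For an ordered $\mathbb{F}$-basis $\mathcal{B}=(\beta_1,\ldots,\beta_n)$ of $\mathbb{L}$, $\phi_{\mathcal{B}}:\mathbb{L}[\sigma]\to\mathbb{F}^{n\times n}$ is the induced $\mathbb{F}$-algebra isomorphism sending $f$ to the matrix whose $j$-th column is the coordinate vector of $f(\beta_j)$ with respect to $\mathcal{B}$. Each $\mathcal{F}_i$ is an $\mathbb{F}$-subspace of $\mathbb{L}$ of dimension $i$, and $\mathcal{F}_{i-1}\subseteq\mathcal{F}_i$. The basis $\mathcal{B}$ is $\mathcal{F}$-compatible if $\langle\beta_1,\ldots,\beta_i\rangle_{\mathbb{F}}=\mathcal{F}_i$ for every $i\in\{1,\ldots,n\}$. Write $[n]=\{1,\ldots,n\}$. A (top-right justified) Ferrers diagram of order $n$ is a subset $\mathcal{D}\subseteq[n]^2$ such that: if $(i,j)\in\mathcal{D}$ and $j\le j'\le n$, then $(i,j')\in\mathcal{D}$; and if $(i,j)\in\mathcal{D}$ and $1\le i'\le i$, then $(i',j)\in\mathcal{D}$. It is identified with the vector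 $(c_1,\ldots,c_n)$, $c_j=|\{i\in[n]:(i,j)\in\mathcal{D}\}|$, so $0\le c_1\le\cdots\le c_n\le n$. $\mathbb{F}^{\mathcal{D}}$ is the space of matrices $(a_{i,j})\in\mathbb{F}^{n\times n}$ with $a_{i,j}=0$ whenever $i>c_j$. A Ferrers diagram $(c_1,\ldots,c_n)$ of order $n$ is monotone if for every $i\in\{1,\ldots,n-1\}$ with $0<c_i<n$ one has $c_{i+1}>c_i$. For a prime $p$, the $p$-height of $\mathcal{D}=(c_1,\ldots,c_n)$ is the largest integer $h\ge0$ such that: (i) $p^h\mid n$; (ii) $p^h\mid c_i$ for all $i\in[n]$; (iii) whenever $r,s\in\{0,\ldots,n-1\}$ both lie in $\{Qp^h,Qp^h+1,\ldots,(Q+1)p^h-1\}$ for some integer $Q\ge0$, one has $c_{n-r}=c_{n-s}$. The $p$-contraction of $\mathcal{D}$ is the Ferrers diagram $\mathcal{D}^{(p)}=(c_1',\ldots,c'_{n/p^h})$ of order $n/p^h$ with $c_i'=c_{p^hi}/p^h$. The diagram $\mathcal{D}$ is $p$-monotone if $\mathcal{D}^{(p)}$ is monotone as a Ferrers diagram of order $n/p^h$. *)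

(* Defs.v *)
From HB Require Import structures.
From mathcomp Require Import all_boot all_order all_algebra.
From mathcomp Require Import all_fingroup all_solvable all_field.

Set Implicit Arguments.
Unset Strict Implicit.
Unset Printing Implicit Defensive.

Import GRing.Theory.
Local Open Scope ring_scope.

(* The skew group algebra L[sigma]: [f : skew_alg sigma] stands for
   \sum_i f i * sigma^i, with i < #[sigma].  The alias hides the pointwise
   product that finite functions carry in the library. *)
Definition skew_alg (F : fieldType) (L : splittingFieldType F)
  (sigma : gal_of {:L}) : Type := {ffun 'I_#[sigma]%g -> L}.

Section SkewAlgebra.
Variables (F : fieldType) (L : splittingFieldType F) (sigma : gal_of {:L}).
Local Notation A := (skew_alg sigma).
Local Notation n := #[sigma]%g.

HB.instance Definition _ := GRing.Lmodule.copy A {ffun 'I_n -> L}.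

(* The monomial a * sigma^i; exponents are read modulo the order of sigma. *)
Definition skew_mono (a : L) (i : nat) : A :=
  [ffun k : 'I_n => if val k == (i %% n)%N then a else 0].

Definition skew_mul (f g : A) : A :=
  \sum_i \sum_j skew_mono (f i * (sigma ^+ i)%g (g j)) (i + j).

Let skewE (f g : A) k : (f + g) k = f k + g k. Proof. exact: ffunE. Qed.

Lemma skew_monoD i : {morph skew_mono ^~ i : a b / a + b}.
Proof.
move=> a b; apply/ffunP=> k; rewrite skewE !ffunE.
by case: ifP => _; rewrite ?addr0.
Qed.

Lemma skew_mono0 i : skew_mono 0 i = 0.
Proof. by apply: (addrI (skew_mono 0 i)); rewrite -skew_monoD !addr0. Qed.

Lemma skew_mono_sum I (r : seq I) (P : pred I) (E : I -> L) i :
  skew_mono (\sum_(x <- r | P x) E x) i = \sum_(x <- r | P x) skew_mono (E x) i.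
Proof. exact: (big_morph _ (skew_monoD i) (skew_mono0 i)). Qed.

Lemma skew_mono_mod a i : skew_mono a (i %% n) = skew_mono a i.
Proof. by apply/ffunP=> k; rewrite !ffunE modn_mod. Qed.

Lemma skew_monoZ c a i : c *: skew_mono a i = skew_mono (c *: a) i.
Proof. by apply/ffunP=> k; rewrite !ffunE; case: ifP; rewrite ?scaler0. Qed.

Lemma skew_sumE (f : A) : f = \sum_i skew_mono (f i) i.
Proof.
apply/ffunP=> k.
have -> : (\sum_i skew_mono (f i) i) k = \sum_i skew_mono (f i) i k.
  apply: (big_morph (fun g : A => g k)) => [g h|]; first exact: skewE.
  exact: ffunE.
rewrite (bigD1 k) //= big1 ?addr0 => [|i ne_ik].
  by rewrite ffunE modn_small // eqxx.
by rewrite ffunE modn_small // eq_sym (inj_eq val_inj) (negPf ne_ik).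
Qed.

Lemma skew_mulDl : left_distributive skew_mul +%R.
Proof.
move=> f g h; rewrite /skew_mul -big_split; apply: eq_bigr => i _ /=.
rewrite -big_split; apply: eq_bigr => j _ /=.
by rewrite skewE mulrDl skew_monoD.
Qed.

Lemma skew_mulDr : right_distributive skew_mul +%R.
Proof.
move=> f g h; rewrite /skew_mul -big_split; apply: eq_bigr => i _ /=.
rewrite -big_split; apply: eq_bigr => j _ /=.
by rewrite skewE rmorphD mulrDr skew_monoD.
Qed.

Lemma skew_mul0l g : skew_mul 0 g = 0.
Proof. by apply: (addrI (skew_mul 0 g)); rewrite -skew_mulDl !addr0. Qed.

Lemma skew_mul0r f : skew_mul f 0 = 0.
Proof. by apply: (addrI (skew_mul f 0)); rewrite -skew_mulDr !addr0. Qed.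

Lemma skew_mul_suml I (r : seq I) (E : I -> A) g :
  skew_mul (\sum_(x <- r) E x) g = \sum_(x <- r) skew_mul (E x) g.
Proof.
by apply: (big_morph (skew_mul^~ g)) => [f h|];
  rewrite ?skew_mulDl ?skew_mul0l.
Qed.

Lemma skew_mul_sumr I (r : seq I) (E : I -> A) f :
  skew_mul f (\sum_(x <- r) E x) = \sum_(x <- r) skew_mul f (E x).
Proof.
by apply: (big_morph (skew_mul f)) => [g h|]; rewrite ?skew_mulDr ?skew_mul0r.
Qed.

Lemma skew_mul_mono a b i j :
  skew_mul (skew_mono a i) (skew_mono b j) =
  skew_mono (a * (sigma ^+ i)%g b) (i + j).
Proof.
have n_gt0 : (0 < n)%N by exact: order_gt0.
pose i0 := Ordinal (ltn_pmod i n_gt0); pose j0 := Ordinal (ltn_pmod j n_gt0).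
rewrite /skew_mul (bigD1 i0) //= [X in _ + X]big1 ?addr0; last first.
  move=> i1 ne_i1; rewrite big1 // => j1 _.
  rewrite ffunE -[(i %% n)%N]/(val i0) (inj_eq val_inj) (negPf ne_i1) mul0r.
  exact: skew_mono0.
rewrite (bigD1 j0) //= [X in _ + X]big1 ?addr0; last first.
  move=> j1 ne_j1.
  rewrite [skew_mono b j j1]ffunE -[(j %% n)%N]/(val j0) (inj_eq val_inj).
  by rewrite (negPf ne_j1) rmorph0 mulr0 skew_mono0.
by rewrite !ffunE !eqxx expg_mod_order -skew_mono_mod modnDm skew_mono_mod.
Qed.

Lemma skew_mulA : associative skew_mul.
Proof.
move=> f g h; rewrite (skew_sumE f) (skew_sumE g) (skew_sumE h).
rewrite [LHS]skew_mul_suml [X in _ = skew_mul X _]skew_mul_suml.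
rewrite [RHS]skew_mul_suml; apply: eq_bigr => i _.
rewrite [X in skew_mul _ X = _]skew_mul_suml [LHS]skew_mul_sumr.
rewrite [X in _ = skew_mul X _]skew_mul_sumr [RHS]skew_mul_suml.
apply: eq_bigr => j _; rewrite [X in skew_mul _ X = _]skew_mul_sumr.
rewrite [LHS]skew_mul_sumr [RHS]skew_mul_sumr; apply: eq_bigr => k _.
rewrite !skew_mul_mono rmorphM mulrA addnA; congr (skew_mono (_ * _) _).
by rewrite addnC expgD galM ?memvf.
Qed.

Lemma skew_mul1 : left_id (skew_mono 1 0) skew_mul.
Proof.
move=> f; rewrite [in RHS](skew_sumE f) {1}(skew_sumE f) skew_mul_sumr.
by apply: eq_bigr => i _; rewrite skew_mul_mono expg0 gal_id mul1r.
Qed.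

Lemma skew_mulr1 : right_id (skew_mono 1 0) skew_mul.
Proof.
move=> f; rewrite [in RHS](skew_sumE f) {1}(skew_sumE f) skew_mul_suml.
by apply: eq_bigr => i _; rewrite skew_mul_mono rmorph1 mulr1 addn0.
Qed.

Lemma skew_one_neq0 : skew_mono 1 0 != 0.
Proof.
apply/eqP=> /ffunP/(_ (Ordinal (order_gt0 sigma))).
by rewrite !ffunE mod0n eqxx => /eqP; rewrite oner_eq0.
Qed.

HB.instance Definition _ := GRing.Zmodule_isNzRing.Build A
  skew_mulA skew_mul1 skew_mulr1 skew_mulDl skew_mulDr skew_one_neq0.

Lemma skew_scaleAl (c : F) (f g : A) : c *: (f * g) = (c *: f) * g.
Proof.
rewrite /GRing.mul /= /skew_mul scaler_sumr; apply: eq_bigr => i _.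
rewrite scaler_sumr; apply: eq_bigr => j _.
by rewrite skew_monoZ scalerAl !ffunE.
Qed.

HB.instance Definition _ := GRing.Lmodule_isLalgebra.Build F A skew_scaleAl.

Lemma skew_scaleAr (c : F) (f g : A) : c *: (f * g) = f * (c *: g).
Proof.
rewrite /GRing.mul /= /skew_mul scaler_sumr; apply: eq_bigr => i _.
rewrite scaler_sumr; apply: eq_bigr => j _.
by rewrite skew_monoZ scalerAr !ffunE linearZ.
Qed.

HB.instance Definition _ := GRing.Lalgebra_isAlgebra.Build F A skew_scaleAr.

Definition skew_const (a : L) : A := skew_mono a 0.
Definition skew_gen : A := skew_mono 1 1.
Definition sigma_bar : A := skew_gen - 1.

Definition skew_eval (f : A) (x : L) : L := \sum_i f i * (sigma ^+ i)%g x.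

Lemma skew_eval_is_linear (f : A) : linear (skew_eval f).
Proof.
move=> c x y; rewrite /skew_eval scaler_sumr -big_split; apply: eq_bigr => i _.
by rewrite linearP mulrDr scalerAr.
Qed.

HB.instance Definition _ (f : A) :=
  GRing.isLinear.Build F L L *:%R (skew_eval f) (skew_eval_is_linear f).

Definition skew_end (f : A) : 'End(L) := linfun (skew_eval f).

Lemma skew_end_is_linear : linear skew_end.
Proof.
move=> c f g; apply/lfunP=> x; rewrite add_lfunE scale_lfunE !lfunE /=.
rewrite /skew_eval scaler_sumr -big_split; apply: eq_bigr => i _ /=.
by rewrite scalerAl -mulrDl !ffunE.
Qed.

HB.instance Definition _ :=
  GRing.isLinear.Build F A 'End(L) *:%R skew_end skew_end_is_linear.

Lemma skew_end1 : skew_end 1 = \1%VF.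
Proof.
apply/lfunP=> x; rewrite !lfunE /= /skew_eval.
rewrite (bigD1 (Ordinal (order_gt0 sigma))) //= big1 ?addr0 => [|i ne_i0].
  by rewrite ffunE mod0n eqxx mul1r expg0 gal_id.
rewrite ffunE mod0n -[0%N]/(val (Ordinal (order_gt0 sigma))) (inj_eq val_inj).
by rewrite (negPf ne_i0) mul0r.
Qed.

Lemma skew_eval_mono a i x : skew_eval (skew_mono a i) x = a * (sigma ^+ i)%g x.
Proof.
pose i0 := Ordinal (ltn_pmod i (order_gt0 sigma)).
rewrite /skew_eval (bigD1 i0) //= big1 ?addr0 => [|j ne_j].
  by rewrite ffunE eqxx expg_mod_order.
by rewrite ffunE -[(i %% n)%N]/(val i0) (inj_eq val_inj) (negPf ne_j) mul0r.
Qed.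

Lemma skew_endM (f g : A) : skew_end (f * g) = (skew_end f \o skew_end g)%VF.
Proof.
apply/lfunP=> x; rewrite [LHS]lfunE comp_lfunE !lfunE /=.
have evalD y : {morph skew_eval^~ y : h k / h + k}.
  by move=> h k; have := skew_end_is_linear 1 h k;
     move/lfunP/(_ y); rewrite !scale1r add_lfunE !lfunE.
have eval0 y : skew_eval 0 y = 0.
  by apply: (addrI (skew_eval 0 y)); rewrite -evalD !addr0.
rewrite {1}/GRing.mul /= /skew_mul (big_morph _ (evalD x) (eval0 x)).
rewrite [in RHS]/skew_eval; apply: eq_bigr => i _.
rewrite (big_morph _ (evalD x) (eval0 x)) rmorph_sum mulr_sumr.
apply: eq_bigr => j _; rewrite skew_eval_mono rmorphM mulrA addnC expgD.
by rewrite galM ?memvf.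
Qed.

(* phi_B: column j holds the coordinates of f(beta_j) in the basis B. *)
Definition skew_mx d (B : d.-tuple L) (f : A) : 'M[F]_d :=
  \matrix_(i, j) coord B i (skew_end f (tnth B j)).

Lemma skew_mx_is_linear d (B : d.-tuple L) : linear (skew_mx B).
Proof.
move=> c f g; apply/matrixP=> i j; rewrite !mxE linearP /=.
by rewrite add_lfunE scale_lfunE linearP.
Qed.

HB.instance Definition _ d (B : d.-tuple L) :=
  GRing.isLinear.Build F A 'M[F]_d *:%R (skew_mx B) (skew_mx_is_linear B).

Definition ker_flag (i : nat) : {vspace L} := lker (skew_end (sigma_bar ^+ i)).

End SkewAlgebra.

Definition flag_compatible (F : fieldType) (L : splittingFieldType F) (n : nat)
    (Fl : nat -> {vspace L}) (B : n.-tuple L) : Prop :=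
  forall i, (1 <= i <= n)%N -> <<take i B>>%VS = Fl i.

(* A pair (i, j) : 'I_n * 'I_n stands for the cell (i + 1, j + 1) of [n]^2. *)
Definition ferrers n (D : {set 'I_n * 'I_n}) : Prop :=
  (forall i j j' : 'I_n, (i, j) \in D -> (j <= j')%N -> (i, j') \in D) /\
  (forall i i' j : 'I_n, (i, j) \in D -> (i' <= i)%N -> (i', j) \in D).

(* c_j, with columns numbered from 1 as in (c_1, ..., c_n). *)
Definition ferrers_col n (D : {set 'I_n * 'I_n}) (j : nat) : nat :=
  #|[set ij in D | ij.2.+1 == j]|.

Definition ferrers_mx (F : fieldType) n (D : {set 'I_n * 'I_n}) (M : 'M[F]_n) :
    Prop :=
  forall i j : 'I_n, (ferrers_col D j.+1 < i.+1)%N -> M i j = 0.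

Definition ferrers_monotone n (D : {set 'I_n * 'I_n}) : Prop :=
  forall i, (1 <= i <= n.-1)%N -> (0 < ferrers_col D i < n)%N ->
    (ferrers_col D i < ferrers_col D i.+1)%N.

Definition p_height_cond (p : nat) n (D : {set 'I_n * 'I_n}) (h : nat) : Prop :=
  [/\ (p ^ h %| n)%N,
      forall i, (1 <= i <= n)%N -> (p ^ h %| ferrers_col D i)%N
    & forall r s, (r < n)%N -> (s < n)%N ->
        (exists Q, (Q * p ^ h <= r < Q.+1 * p ^ h)%N /\
                   (Q * p ^ h <= s < Q.+1 * p ^ h)%N) ->
        ferrers_col D (n - r) = ferrers_col D (n - s)].

Definition is_p_height (p : nat) n (D : {set 'I_n * 'I_n}) (h : nat) : Prop :=
  p_height_cond p D h /\ forall k, p_height_cond p D k -> (k <= h)%N.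

(* The diagram of order n / p^h with columns c'_j = c_(p^h j) / p^h. *)
Definition p_contraction (p h : nat) n (D : {set 'I_n * 'I_n}) :
    {set 'I_(n %/ p ^ h) * 'I_(n %/ p ^ h)} :=
  [set ij : 'I_(n %/ p ^ h) * 'I_(n %/ p ^ h) |
    (ij.1.+1 <= ferrers_col D (p ^ h * ij.2.+1) %/ p ^ h)%N].

Definition p_monotone (p : nat) n (D : {set 'I_n * 'I_n}) : Prop :=
  exists2 h, is_p_height p D h & ferrers_monotone (p_contraction p h D).

Lemma p_height_exists (p n : nat) (D : {set 'I_n * 'I_n}) :
  prime p -> (0 < n)%N -> exists! h, is_p_height p D h.
Proof.
move=> p_pr n_gt0.
pose P h := [&& p ^ h %| n, [forall i : 'I_n, p ^ h %| ferrers_col D i.+1] &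
  [forall r : 'I_n, [forall s : 'I_n,
     (r %/ p ^ h == s %/ p ^ h) ==>
       (ferrers_col D (n - r) == ferrers_col D (n - s))]]]%N.
have PP h : p_height_cond p D h <-> P h.
  have ph_gt0 : (0 < p ^ h)%N by rewrite expn_gt0 prime_gt0.
  have divE t Q : (Q * p ^ h <= t < Q.+1 * p ^ h)%N = (t %/ p ^ h == Q)%N.
    by rewrite -leq_divRL // -ltn_divLR // eqn_leq andbC.
  split=> [[dn dc cc]|/and3P[dn /forallP dc /forallP cc]].
    apply/and3P; split=> //.
      by apply/forallP=> i; apply: dc; rewrite ltn_ord.
    apply/forallP=> r; apply/forallP=> s; apply/implyP=> /eqP eq_rs.
    apply/eqP/cc => //; exists (r %/ p ^ h)%N.
    by rewrite !divE eq_rs !eqxx.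
  split=> //.
    by case=> // i lt_in; apply: (dc (Ordinal (_ : (i < n)%N))).
  move=> r s lt_r lt_s [Q []].
  rewrite !divE => /eqP rQ /eqP sQ.
  have /forallP/(_ (Ordinal lt_s))/implyP := cc (Ordinal lt_r).
  by rewrite /= rQ sQ => /(_ (eqxx Q))/eqP.
have P0 : P 0%N.
  apply/and3P; split; rewrite ?dvd1n //.
    by apply/forallP=> i; rewrite dvd1n.
  apply/forallP=> r; apply/forallP=> s; rewrite !divn1.
  by apply/implyP=> /eqP ->.
have bP h : P h -> (h <= n)%N.
  case/and3P=> /(dvdn_leq n_gt0) le_n _ _; apply: leq_trans le_n.
  exact: ltnW (ltn_expl _ (prime_gt1 p_pr)).
case: (ex_maxnP (ex_intro _ 0%N P0) bP) => h Ph maxh; exists h; split.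
  by split=> [|k /PP]; [apply/PP | apply: maxh].
move=> k [/PP Pk maxk]; apply/eqP; rewrite eqn_leq maxh //.
by rewrite maxk //; apply/PP.
Qed.

Lemma ferrers_col_contraction (p h n : nat) (D : {set 'I_n * 'I_n}) j :
  prime p -> (p ^ h %| n)%N -> (1 <= j <= n %/ p ^ h)%N ->
  ferrers_col (p_contraction p h D) j = (ferrers_col D (p ^ h * j) %/ p ^ h)%N.
Proof.
move=> p_pr dvd_n /andP[j_gt0 le_j]; set q := (p ^ h)%N.
have q_gt0 : (0 < q)%N by rewrite expn_gt0 prime_gt0.
have colD k : (ferrers_col D k <= n)%N.
  have <- : #|[set ij.1 | ij in [set ij in D | ij.2.+1 == k]]|
      = ferrers_col D k.
    apply: card_in_imset => -[a b] [c d]; rewrite !inE /=.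
    move=> /andP[_ /eqP eb] /andP[_ /eqP ed] ->.
    by congr (_, _); apply: val_inj; apply: succn_inj; rewrite eb ed.
  by rewrite -[X in (_ <= X)%N]card_ord; apply: max_card.
have lt_j : (j.-1 < n %/ q)%N by rewrite prednK.
pose jo := Ordinal lt_j; set c := (ferrers_col D _ %/ q)%N.
have le_c : (c <= n %/ q)%N by rewrite leq_div2r.
rewrite -[RHS]card_ord /ferrers_col.
have inj_f : injective (fun i : 'I_c => (widen_ord le_c i, jo)).
  by move=> a b [e]; apply: val_inj.
rewrite -[RHS](card_imset _ inj_f); apply: eq_card => -[a b].
rewrite !inE /=; apply/andP/imsetP => [[lt_a /eqP e]|[i _ [-> ->]]].
  rewrite e in lt_a; exists (Ordinal lt_a) => //.
  by congr (_, _); apply: val_inj => //=; rewrite -e.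
by rewrite /= prednK //; split.
Qed.

(* f maps the set X isomorphically, as an F-vector space, onto the set Y. *)
Definition vs_iso_onto (F : fieldType) (U V : lmodType F) (f : {linear U -> V})
    (X : U -> Prop) (Y : V -> Prop) : Prop :=
  [/\ X 0 /\ (forall (a : F) u v, X u -> X v -> X (a *: u + v)),
      Y 0 /\ (forall (a : F) u v, Y u -> Y v -> Y (a *: u + v)),
      forall u v, X u -> X v -> f u = f v -> u = v
    & forall y, Y y <-> exists2 x, X x & f x = y].

(* L[sigma; D]; the coefficient lambda_(i+1) is [lam i]. *)
Definition skew_ferrers (F : fieldType) (L : splittingFieldType F)
    (sigma : gal_of {:L}) n (D : {set 'I_n * 'I_n})
    (f : skew_alg sigma) : Prop :=
  exists2 lam : 'I_n -> L,
    forall i : 'I_n, lam i \in ker_flag sigma (ferrers_col D i.+1) &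
    f = \sum_(i < n) skew_const sigma (lam i) * sigma_bar sigma ^+ i.

(* Main.v *)
(** Write T = sigma - 1, so that F_i = ker T^i.  From
    T(xy) = T(x) y + x T(y) + T(x) T(y) one gets F_a F_b <= F_(a+b-1).  In
    characteristic p, T^q = sigma^q - 1 for q = p^h, so the same argument
    applied to sigma^q gives F_(qa) F_(qb) <= F_(q(a+b-1)); with the
    monotonicity of the p-contraction this yields
    F_(c_i) F_(j-i+1) <= F_(c_j) for i <= j.  Hence the system
    f(beta_j) = \sum_i lambda_i T^(i-1)(beta_j), which is triangular with
    diagonal entries in F_1 \ {0}, has f(beta_j) in F_(c_j) for all j exactly
    when lambda_i is in F_(c_i) for all i. *)

Require Import Defs.
From mathcomp Require Import all_boot all_order all_algebra.
From mathcomp Require Import all_fingroup all_solvable all_field.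
From mathcomp Require Import zify.

Set Implicit Arguments.
Unset Strict Implicit.
Unset Printing Implicit Defensive.

Import GRing.Theory.
Local Open Scope ring_scope.

(** * Difference operators [tau - id] of ring endomorphisms *)

Definition diff_op (R : zmodType) (f : R -> R) (x : R) : R := f x - x.

Section DifferenceOperator.
Variables (R : nzRingType) (tau : {rmorphism R -> R}).
Local Notation diff_op := (diff_op tau).

Lemma diff_op0 : diff_op 0 = 0.
Proof. by rewrite /diff_op rmorph0 subrr. Qed.

Lemma diff_opD : {morph diff_op : x y / x + y}.
Proof. by move=> x y; rewrite /diff_op rmorphD opprD addrACA. Qed.

Lemma diff_opM x y :
  diff_op (x * y) = diff_op x * y + x * diff_op y + diff_op x * diff_op y.
Proof.
rewrite -addrA -mulrDl [x + _]addrC subrK /diff_op rmorphM mulrBl mulrBr.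
by rewrite addrC addrA subrK.
Qed.

Lemma iter_diff_op0 k : iter k diff_op 0 = 0.
Proof. by elim: k => //= k ->; rewrite diff_op0. Qed.

Lemma iter_diff_opD k : {morph iter k diff_op : x y / x + y}.
Proof. by elim: k => // k IHk x y; rewrite !iterS IHk diff_opD. Qed.

(** By the product rule, one application to [x * y] leaves three products, in each of which [a] or
    [b] has dropped by one; once either reaches 0, that factor is 0. Keeping [tau] general allows
    both [sigma] and its [p ^ h]-th power. *)
Lemma iter_diff_opM_eq0 k a b x y : (a + b <= k.+1)%N ->
  iter a diff_op x = 0 -> iter b diff_op y = 0 -> iter k diff_op (x * y) = 0.
Proof.
elim: k a b x y => [|k IHk] [|a] [|b] x y le_ab;
  try by [move=> x0 _; rewrite (x0 : x = 0) mul0r iter_diff_op0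
         |move=> _ y0; rewrite (y0 : y = 0) mulr0 iter_diff_op0 | lia].
move=> x0 y0; have := y0; have := x0; rewrite !iterSr => Dx0 Dy0.
rewrite diff_opM !iter_diff_opD (IHk _ _ _ _ _ Dx0 y0); last by lia.
rewrite (IHk _ _ _ _ _ x0 Dy0) ?(IHk _ _ _ _ _ Dx0 Dy0) ?addr0 //; lia.
Qed.

End DifferenceOperator.

(** [R] may be noncommutative, but [x] commutes with 1, which is enough for Frobenius to respect
    this difference. *)
Lemma Frobenius_subX (R : nzRingType) (p : nat) (x : R) h :
  p \in [pchar R] -> (x - 1) ^+ (p ^ h) = x ^+ (p ^ h) - 1.
Proof.
move=> charR; elim: h => [|h IHh]; first by rewrite !expr1.
rewrite expnSr !exprM IHh -!(pFrobenius_autE charR) pFrobenius_autB_comm.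
  by rewrite pFrobenius_aut1.
exact: commr1.
Qed.

(** * The kernel flag and its products *)

Section KerFlag.
Variables (F : fieldType) (L : splittingFieldType F) (sigma : gal_of {:L}).
Implicit Types (x y : L) (i k : nat).

Lemma skew_end_const (a x : L) : skew_end (skew_const sigma a) x = a * x.
Proof. by rewrite lfunE /= skew_eval_mono expg0 gal_id. Qed.

Lemma skew_genX i : skew_gen sigma ^+ i = skew_mono sigma 1 i.
Proof.
elim: i => [|i IHi]; first by rewrite expr0.
rewrite exprS IHi; apply: etrans (skew_mul_mono _ _ _ _ _) _.
by rewrite rmorph1 mul1r.
Qed.

Lemma skew_end_genX_sub1 i x :
  skew_end (skew_gen sigma ^+ i - 1) x = diff_op (sigma ^+ i)%g x.
Proof.
rewrite linearB /= add_lfunE opp_lfunE skew_end1 id_lfunE skew_genX lfunE /=.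
by rewrite skew_eval_mono mul1r.
Qed.

Lemma skew_endX (f : skew_alg sigma) k x :
  skew_end (f ^+ k) x = iter k (skew_end f) x.
Proof.
elim: k => [|k IHk]; first by rewrite expr0 skew_end1 id_lfunE.
by rewrite exprS skew_endM comp_lfunE IHk.
Qed.

Lemma skew_end_sigma_barX k x :
  skew_end (sigma_bar sigma ^+ k) x = iter k (diff_op sigma) x.
Proof.
rewrite skew_endX; apply: eq_iter => y.
by rewrite -[sigma_bar _]/(skew_gen sigma ^+ 1 - 1) skew_end_genX_sub1.
Qed.

Lemma mem_ker_flag k x :
  (x \in ker_flag sigma k) = (iter k (diff_op sigma) x == 0).
Proof. by rewrite memv_ker skew_end_sigma_barX. Qed.

(** The skew group algebra inherits characteristic [p] from [F], so there
    [T^(p^h) = sigma^(p^h) - 1], where [T = sigma - 1]. *)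
Lemma mem_ker_flagX p h k x : p \in [pchar F] ->
  (x \in ker_flag sigma (p ^ h * k)) =
  (iter k (diff_op (sigma ^+ (p ^ h))%g) x == 0).
Proof.
move=> charF; have charA : p \in [pchar skew_alg sigma].
  exact: (rmorph_pchar (in_alg (skew_alg sigma))).
rewrite memv_ker exprM skew_endX /sigma_bar Frobenius_subX //.
by rewrite (eq_iter (skew_end_genX_sub1 _)).
Qed.

Lemma mem_ker_flagM a b k x y : (a + b <= k.+1)%N ->
  x \in ker_flag sigma a -> y \in ker_flag sigma b ->
  x * y \in ker_flag sigma k.
Proof.
rewrite !mem_ker_flag => le_ab /eqP x0 /eqP y0.
apply/eqP; exact: iter_diff_opM_eq0 le_ab x0 y0.
Qed.

(** The product bound applied to [x * 1], since [T] kills 1. *)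
Lemma ker_flagS i k : (i <= k)%N -> (ker_flag sigma i <= ker_flag sigma k)%VS.
Proof.
move=> le_ik; apply/subvP=> x Kx; rewrite -[x]mulr1.
apply: mem_ker_flagM Kx (_ : 1 \in ker_flag sigma 1); first by rewrite addn1.
by rewrite mem_ker_flag /= /diff_op rmorph1 subrr.
Qed.

Lemma mem_ker_flag0 x : x \in ker_flag sigma 0 -> x = 0.
Proof. by rewrite mem_ker_flag => /eqP. Qed.

(** The first kernel is the fixed field of [sigma]. *)
Lemma mem_ker_flag1V x : x \in ker_flag sigma 1 -> x^-1 \in ker_flag sigma 1.
Proof.
rewrite !mem_ker_flag /= /diff_op !subr_eq0 => sx.
by apply/eqP; rewrite fmorphV; congr (_^-1); apply/eqP.
Qed.

End KerFlag.

(** * Column heights of [p]-monotone diagrams *)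

Lemma leq_ferrers_col n (D : {set 'I_n * 'I_n}) i j :
  ferrers D -> (i <= j <= n)%N -> (ferrers_col D i <= ferrers_col D j)%N.
Proof.
(* Columns are numbered from 1, so column 0 is empty. *)
move=> [Dr _] /andP[le_ij le_jn]; case: i le_ij => [|i] le_ij.
  by rewrite /ferrers_col eq_card0 // => -[a b]; rewrite !inE andbF.
have lt_j : (j.-1 < n)%N by lia.
(* Slide the cells of column [i] to the right into column [j]. *)
pose f (ij : 'I_n * 'I_n) := (ij.1, Ordinal lt_j).
have f_inj : {in [set ij in D | ij.2.+1 == i.+1] &, injective f}.
  move=> [a b] [a' b']; rewrite !inE => /andP[_ /eqP[eb]] /andP[_ /eqP[eb']].
  by case=> ->; congr (_, _); apply: val_inj; rewrite /= eb eb'.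
rewrite /ferrers_col -(card_in_imset f_inj).
apply/subset_leq_card/subsetP=> _ /imsetP[[a b] + ->].
rewrite !inE => /andP[Dab /eqP[eb]]; rewrite prednK ?eqxx ?andbT; last by lia.
by apply: Dr Dab _; rewrite /= eb; lia.
Qed.

(** The blocks of equal columns are counted from the right; as [p ^ h] divides [n], they are also
    blocks from the left. The last column of a block is the one that the contraction samples. *)
Lemma p_height_col_block p n (D : {set 'I_n * 'I_n}) h i :
  (0 < p)%N -> p_height_cond p D h -> (1 <= i <= n)%N ->
  ferrers_col D i = ferrers_col D (p ^ h * (i.-1 %/ p ^ h).+1).
Proof.
move=> p_gt0 [/dvdnP[n' nE] _ cc] i_in.
have q_gt0 : (0 < p ^ h)%N by rewrite expn_gt0 p_gt0.
move: (p ^ h)%N => q in nE cc q_gt0 *.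
have := divn_eq i.-1 q; have := ltn_pmod i.-1 q_gt0.
move: (i.-1 %/ q)%N (i.-1 %% q)%N => I r lt_r iE.
have lt_I : (I < n')%N by rewrite -(ltn_pmul2r q_gt0); lia.
have le_I : (q * I.+1 <= n)%N by rewrite nE mulnC leq_mul2r lt_I orbT.
have nq : (n = (n' - I.+1) * q + I * q + q)%N.
  by rewrite -mulnDl -mulSnr nE; congr (_ * _)%N; lia.
have := cc (n - i)%N (n - q * I.+1)%N; rewrite !subKn //; last by lia.
apply; try lia.
(* Block [I] from the left is block [n' - I.+1] from the right. *)
by exists (n' - I.+1)%N; rewrite !mulSn !mulnS [(q * I)%N]mulnC; lia.
Qed.

(** From a nonempty column on, each step gains at least one cell until the full height is reached;
    the minimum accounts for that saturation. *)
Lemma monotone_contraction_growth p n (D : {set 'I_n * 'I_n}) h I d :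
  prime p -> ferrers D -> (p ^ h %| n)%N ->
  ferrers_monotone (p_contraction p h D) ->
  let c k := (ferrers_col D (p ^ h * k) %/ p ^ h)%N in
  (0 < I)%N -> (I + d <= n %/ p ^ h)%N -> (0 < c I)%N ->
  (minn (n %/ p ^ h) (c I + d) <= c (I + d))%N.
Proof.
move=> p_pr ferD dvd_n monD c I_gt0 + cI_gt0.
have q_gt0 : (0 < p ^ h)%N by rewrite expn_gt0 prime_gt0.
have c_mono k : (k < n %/ p ^ h)%N -> (c k <= c k.+1)%N.
  move=> lt_k; apply/leq_div2r/leq_ferrers_col; rewrite ?leq_pmul2l // leqnSn.
  by rewrite mulnC -leq_divRL.
elim: d => [|d IHd] le_d; first by rewrite !addn0 geq_minr.
have {IHd} := IHd ltac:(lia); rewrite !addnS => IHd.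
have := c_mono (I + d)%N ltac:(lia).
have := monD (I + d)%N ltac:(lia).
rewrite !ferrers_col_contraction -/(c _) //; try lia.
by rewrite -/(c _); lia.
Qed.

(** Everything is rounded to blocks of length [p ^ h], so that the product bound for the [p ^ h]-th
    power of [sigma] meets the growth of the contracted columns. *)
Lemma ker_flag_ferrers_mul (p n : nat) (F : fieldType)
    (L : splittingFieldType F) (sigma : gal_of {:L}) (D : {set 'I_n * 'I_n})
    i j (x y : L) :
  prime p -> p \in [pchar F] -> ker_flag sigma n = fullv ->
  ferrers D -> p_monotone p D -> (1 <= i <= j)%N -> (j <= n)%N ->
  x \in ker_flag sigma (ferrers_col D i) ->
  y \in ker_flag sigma (j.+1 - i) ->
  x * y \in ker_flag sigma (ferrers_col D j).
Proof.
move=> p_pr charF Kn ferD [h [hD _] monD] le_ij le_jn.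
have [dvd_n dvd_c _] := hD; have p_gt0 := prime_gt0 p_pr.
have q_gt0 : (0 < p ^ h)%N by rewrite expn_gt0 p_gt0.
rewrite [ferrers_col D i](p_height_col_block p_gt0 hD); last by lia.
rewrite [ferrers_col D j](p_height_col_block p_gt0 hD); last by lia.
set I := (i.-1 %/ p ^ h)%N; set J := (j.-1 %/ p ^ h)%N.
have le_IJ : (I <= J)%N by apply: leq_div2r; lia.
have lt_J : (J < n %/ p ^ h)%N by rewrite ltn_divLR // divnK //; lia.
have colE k : (k < n %/ p ^ h)%N -> ferrers_col D (p ^ h * k.+1) =
    (p ^ h * (ferrers_col D (p ^ h * k.+1) %/ p ^ h))%N.
  move=> lt_k; rewrite [RHS]mulnC divnK // dvd_c // muln_gt0 q_gt0 /=.
  by rewrite mulnC -leq_divRL.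
have := @monotone_contraction_growth p n D h I.+1 (J - I) p_pr ferD dvd_n monD.
rewrite /= addSn subnKC // => /(_ isT lt_J).
rewrite (colE I) 1?(colE J) ?mulKn //; last by lia.
set cI := (_ %/ _)%N; set cJ := (_ %/ _)%N => growth.
have [->|cI_gt0] := posnP cI.
  by rewrite muln0 => /mem_ker_flag0-> _; rewrite mul0r mem0v.
(* Either column [J] is full and its kernel is all of [L], or it has grown by at least [J - I]. *)
have {growth cI_gt0} := growth cI_gt0; rewrite geq_min => /orP[le_cJ|le_cJ].
  move=> _ _; apply: (subvP (@ker_flagS _ _ sigma n _ _)).
    by rewrite -[X in (X <= _)%N](divnK dvd_n) mulnC leq_pmul2l.
  by rewrite Kn memvf.
(* Columns [i] to [j] lie within the blocks [I] to [J]. *)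
have le_d : (j.+1 - i <= p ^ h * (J - I).+1)%N.
  have := divn_eq i.-1 (p ^ h); have := divn_eq j.-1 (p ^ h).
  have := ltn_pmod j.-1 q_gt0; rewrite -/I -/J mulnS mulnBr.
  have : (I * p ^ h <= J * p ^ h)%N by rewrite leq_mul2r le_IJ orbT.
  by rewrite ![(p ^ h * _)%N]mulnC; lia.
move=> Kx /(subvP (ker_flagS sigma le_d)); move: Kx.
rewrite !mem_ker_flagX // => /eqP x0 /eqP y0.
apply/eqP; apply: iter_diff_opM_eq0 x0 y0; lia.
Qed.

(** * Triangular matrices and coordinates *)

Lemma unitmx_triu (K : fieldType) n (W : 'M[K]_n) :
  (forall i j : 'I_n, (j < i)%N -> W i j = 0) -> (forall i, W i i != 0) ->
  W \in unitmx.
Proof.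
move=> W0 Wd; rewrite -unitmx_tr unitmxE det_trig.
  by rewrite unitfE; apply/prodf_neq0 => i _; rewrite mxE.
by apply/is_trig_mxP=> i j lt_ij; rewrite mxE W0.
Qed.

Lemma coord_span_take (K : fieldType) (V : vectType K) n (B : n.-tuple V)
    c (i : 'I_n) v :
  free B -> (c <= i)%N -> v \in <<take c B>>%VS -> coord B i v = 0.
Proof.
move=> freeB le_ci Bv.
pose cB : 'Hom(V, K^o) := linfun (coord B i : V -> K^o).
suff /subvP/(_ v Bv) : (<<take c B>> <= lker cB)%VS.
  by rewrite memv_ker lfunE /= => /eqP.
apply/span_subvP=> u /(nthP 0)[k]; rewrite size_take_min leq_min size_tuple.
case/andP=> lt_kc lt_kn <-; rewrite nth_take // memv_ker lfunE /=.
rewrite -[k]/(val (Ordinal lt_kn)) coord_free // -val_eqE /=.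
by rewrite ltn_eqF // (leq_trans lt_kc).
Qed.

(** * The triangular system linking values on the basis to coefficients *)

Theorem theorem3p4 (p m n : nat) (p_prime : prime p) (m_gt0 : (0 < m)%N)
  (n_def : n = (p ^ m)%N)
  (F : fieldType) (charF : p \in [pchar F])
  (L : splittingFieldType F) (degL : \dim {:L} = n)
  (galL : galois 1 {:L})
  (sigma : gal_of {:L}) (sigma_gen : 'Gal({:L} / 1)%g = <[sigma]>%g)
  (D : {set 'I_n * 'I_n}) (ferD : ferrers D) (monD : p_monotone p D)
  (B : n.-tuple L) (basisB : basis_of {:L} B)
  (compB : flag_compatible (ker_flag sigma) B) :
  vs_iso_onto (skew_mx B) (skew_ferrers D (sigma := sigma))
    (@ferrers_mx F n D).
Proof.
have n_gt0 : (0 < n)%N by rewrite n_def expn_gt0 prime_gt0.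
have freeB := basis_free basisB.
have Kn : ker_flag sigma n = fullv.
  rewrite -(compB n) ?n_gt0 ?leqnn // take_oversize ?size_tuple //.
  exact: span_basis.
pose c (j : 'I_n) := ferrers_col D j.+1.
pose K := ker_flag sigma.
have KB (j : 'I_n) : B`_j \in K j.+1.
  rewrite /K -(compB j.+1) ?ltn_ord // memv_span //; apply/(nthP 0).
  by exists j; rewrite ?nth_take // size_take_min size_tuple leq_min ltnSn /=.
have KBn (j : 'I_n) : B`_j \notin K j.
  (* Compatibility says nothing at index 0, where the kernel is zero. *)
  have [j0|j_gt0] := posnP j.
    have : B`_j != 0 by apply/(free_not0 freeB)/mem_nth; rewrite size_tuple.
    by rewrite /K j0; apply: contra => /mem_ker_flag0->.
  rewrite /K -compB ?j_gt0 1?ltnW //; apply/negP => /(coord_span_take freeB).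
  by move=> /(_ j (leqnn j))/eqP; rewrite coord_free // eqxx oner_eq0.
(* The row of coefficients times [W] is the row of values on the basis. [W] is upper triangular with
   nonzero diagonal, hence invertible. *)
pose W : 'M[L]_n := \matrix_(i, j) iter i (diff_op sigma) B`_j.
have KW (i j : 'I_n) : (i <= j)%N -> W i j \in K (j.+1 - i)%N.
  move=> le_ij; rewrite mxE /K mem_ker_flag -iterD subnK; last by lia.
  by rewrite -mem_ker_flag KB.
have W0 (i j : 'I_n) : (j < i)%N -> W i j = 0.
  move=> lt_ji; rewrite mxE; apply/eqP; rewrite -mem_ker_flag.
  exact: subvP (ker_flagS sigma lt_ji) _ (KB j).
have Wd i : W i i != 0 by rewrite mxE -mem_ker_flag KBn.
have Wu : W \in unitmx by exact: unitmx_triu.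
have KM (i j : 'I_n) x : (i <= j)%N -> x \in K (c i) -> x * W i j \in K (c j).
  move=> le_ij Kx; have := KW i j le_ij; rewrite -subSS => KWij.
  exact: (@ker_flag_ferrers_mul p n F L sigma D i.+1 j.+1 x (W i j)).
pose Phi (lam : 'I_n -> L) : skew_alg sigma :=
  \sum_(i < n) skew_const sigma (lam i) * sigma_bar sigma ^+ i.
have PhiE lam (j : 'I_n) :
    skew_end (Phi lam) B`_j = ((\row_i lam i) *m W) 0 j.
  rewrite linear_sum sum_lfunE mxE; apply: eq_bigr => i _ /=.
  rewrite skew_endM comp_lfunE skew_end_const skew_end_sigma_barX.
  by rewrite !mxE.
have mxPhi lam (i j : 'I_n) :
    skew_mx B (Phi lam) i j = coord B i (((\row_k lam k) *m W) 0 j).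
  by rewrite mxE (tnth_nth 0) PhiE.
split.
- split=> [|a _ _ [lu Ku ->] [lv Kv ->]].
    exists (fun=> 0) => [i|]; first exact: mem0v.
    by rewrite big1 // => i _; rewrite /skew_const skew_mono0 mul0r.
  exists (fun i => a *: lu i + lv i) => [i|]; first by rewrite memvD ?memvZ.
  rewrite scaler_sumr -big_split; apply: eq_bigr => i _ /=.
  by rewrite scalerAl -mulrDl /skew_const skew_monoD skew_monoZ.
- split=> [i j _|a u v u0 v0 i j lt_c]; rewrite !mxE // u0 // v0 //.
  by rewrite mulr0 addr0.
- move=> _ _ [lu _ ->] [lv _ ->] /matrixP eq_uv.
  (* Equal matrices give equal values on the basis; then [W] cancels. *)
  have eq_row : \row_i lu i = \row_i lv i.
    apply: (can_inj (mulmxK Wu)); apply/rowP=> j.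
    rewrite [LHS](coord_basis basisB) ?memvf //.
    rewrite [RHS](coord_basis basisB) ?memvf //.
    by apply: eq_bigr => i _; rewrite -!mxPhi [X in X *: _]eq_uv.
  apply: eq_bigr => i _; congr (skew_const _ _ * _).
  by move/rowP/(_ i): eq_row; rewrite !mxE.
move=> M; split=> [M0|[_ [lam Klam ->] <-] i j lt_c]; last first.
  rewrite mxPhi; have : ((\row_k lam k) *m W) 0 j \in K (c j).
    rewrite mxE memv_suml // => k _; rewrite mxE.
    have [le_kj|lt_jk] := leqP k j; first exact: KM.
    by rewrite W0 // mulr0 mem0v.
  (* An empty column forces the value to be 0; otherwise the value lies in the span of the first
     [c j] basis vectors. *)
  have [c0|c_gt0] := posnP (c j).
    by rewrite c0 => /mem_ker_flag0->; rewrite linear0.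
  rewrite /K -compB; last by rewrite c_gt0 (leq_trans (ltnSE lt_c)) // ltnW.
  exact: coord_span_take.
(* For surjectivity: the values on the basis that [M] prescribes, solved for the coefficients
   through the inverse of [W]. *)
pose g : 'rV[L]_n := \row_j \sum_i M i j *: B`_i.
have Kg j : g 0 j \in K (c j).
  rewrite mxE memv_suml // => i _; have [lt_c|le_c] := ltnP (c j) i.+1.
    by rewrite M0 // scale0r mem0v.
  by rewrite memvZ // (subvP (ker_flagS sigma le_c)).
pose lam i := (g *m invmx W) 0 i.
have lamW : (\row_i lam i) *m W = g.
  by rewrite -[RHS](mulmxKV Wu); congr (_ *m _); apply/rowP=> i; rewrite mxE.
exists (Phi lam); last first.
  apply/matrixP=> i j; rewrite mxPhi lamW mxE linear_sum (bigD1 i) //=.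
  rewrite linearZ /= coord_free // eqxx mulr1 big1 ?addr0 // => k /negPf ne_ki.
  by rewrite linearZ /= coord_free // ne_ki mulr0.
(* Strong induction on [j]: equation [j] expresses [lam j] through the earlier coefficients. *)
exists lam => // j; have [N] := ubnP (val j); elim: N j => // N IHN j lt_jN.
have lamE : lam j = (W j j)^-1 * (g 0 j - \sum_(i < n | i != j) lam i * W i j).
  suff -> : g 0 j = \sum_i lam i * W i j.
    by rewrite (bigD1 j) //= addrK mulrC mulfK.
  rewrite -[in LHS]lamW [LHS]mxE; apply: eq_bigr => i _.
  by congr (_ * _); rewrite mxE.
(* The diagonal entry lies in the fixed field, so dividing by it preserves [K (c j)]. *)
rewrite lamE; apply: (@mem_ker_flagM _ _ _ 1 (c j)); first by [].
  by apply: mem_ker_flag1V; have := KW j j (leqnn j); rewrite subSnn.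
rewrite memvB // memv_suml // => i ne_ij.
have [lt_ij|lt_ji|/val_inj eq_ij] := ltngtP (val i) (val j).
- by apply: KM; [apply: ltnW | apply: IHN; apply: leq_trans lt_ij _].
- by rewrite W0 // mulr0 mem0v.
by rewrite eq_ij eqxx in ne_ij.
Qed.
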